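(* Let $B,D\in\widehat{\mathbb F_q^\times}$ and set $C=D^2$. Assume $D\neq\phi$ and $B\neq D$. Then for all $x\in\mathbb F_q$, $$\overline C(1-x)\,{}_2\mathbb F_1\!\left[\begin{matrix}D\phi\overline B&D\\&C\overline B\end{matrix};\frac{-4x}{(1-x)^2}\right]={}_2\mathbb F_1\!\left[\begin{matrix}B&C\\&C\overline B\end{matrix};x\right]-\delta(1-x)\frac{J(C,\overline B^2)}{J(C,\overline B)}-\delta(1+x)\frac{J(\overline B,D\phi)}{J(C,\overline B)},$$ where for $x=1$ the left-hand side is interpreted as $0$.
   Context: $\mathbb F_q$ is a finite field with $q$ elements, $q$ a power of an odd prime $p$. $\widehat{\mathbb F_q^\times}$ is the group of multiplicative characters $\chi:\mathbb F_q^\times\to\mathbb C^\times$; every character, including the trivial character $\varepsilon$, is extended to $\mathbb F_q$ by $\chi(0)=0$. $\phi$ is the quadratic character, $\overline\chi$ denotes the complex-conjugate (inverse) character, and products/powers of characters are pointwise. For $x\in\mathbb F_q$, $\delta(x)=1$ if $x=0$ and $0$ otherwise. Jacobi sum: $J(A,B)=\sum_{x\in\mathbb F_q}A(x)B(1-x)$. Period function: ${}_2\mathbb P_1\!\left[\begin{matrix}A&B\\&C\end{matrix};\lambda\right]=\sum_{y\in\mathbb F_q}B(y)\,\overline BC(1-y)\,\overline A(1-\lambda y)$; normalized function ${}_2\mathbb F_1\!\left[\begin{matrix}A&B\\&C\end{matrix};\lambda\right]=\frac{1}{J(B,C\overline B)}\,{}_2\mathbb P_1\!\left[\begin{matrix}A&B\\&C\end{matrix};\lambda\right]$.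 *)

(* Defs.v *)
From HB Require Import structures.
From mathcomp Require Import all_boot all_order all_algebra all_field.
Set Implicit Arguments. Unset Strict Implicit. Unset Printing Implicit Defensive.
Import Order.TTheory GRing.Theory Num.Theory.
Local Open Scope ring_scope.

Section Chars.
Variable F : finFieldType.

(* A multiplicative character chi : F^x -> C^x, extended to F by chi(0) = 0.
   Such extended maps are exactly the maps F -> C with chi 0 = 0, chi 1 = 1,
   chi (x y) = chi x chi y. *)
Definition is_mchar (chi : F -> algC) : Prop :=
  [/\ chi 0 = 0, chi 1 = 1 & forall x y, chi (x * y) = chi x * chi y].

Definition qchar (x : F) : algC :=
  if x == 0 then 0 else if [exists y : F, y ^+ 2 == x] then 1 else -1.

Definition cconj (chi : F -> algC) : F -> algC := fun x => (chi x)^*.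
Definition cmul (A B : F -> algC) : F -> algC := fun x => A x * B x.

Definition kdelta (x : F) : algC := if x == 0 then 1 else 0.

Definition Jac (A B : F -> algC) : algC := \sum_(x : F) A x * B (1 - x).

Definition P21 (A B C : F -> algC) (lam : F) : algC :=
  \sum_(y : F) B y * cmul (cconj B) C (1 - y) * cconj A (1 - lam * y).

Definition F21 (A B C : F -> algC) (lam : F) : algC :=
  P21 A B C lam / Jac B (cmul C (cconj B)).
End Chars.

(* Main.v *)
Require Import Defs.
From HB Require Import structures.
From mathcomp Require Import all_boot all_order all_algebra all_field.
From mathcomp Require Import ring.
From Stdlib Require Import FunctionalExtensionality.
Import Order.TTheory GRing.Theory Num.Theory.
Local Open Scope ring_scope.

(** Write [nu = (1 + x) / (1 - x)], so that [1 - lam = nu^2] for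
    [lam = - 4 x / (1 - x)^2].  Up to a Jacobi sum, the period function on the
    left is the symmetric double sum of
    [A(a) D(b) conj(C Bb)(1 + a + b + nu^2 a b)] with [A = D phi Bb].
    Replacing [a] by [1/a] leaves the characters [D phi] and [D] on [a] and
    [b], so for fixed [p = a b] the sum over [a] is of Salie type,
    [sum phi(a) h(a + c / a)] with [c = nu^2 p], and becomes a sum over the
    square roots of [c].  What remains is
    [sum_r (B phi)(r) k(r + 1/r - 2 nu)] with [k] homogeneous.  A second
    Salie-type identity expresses the fibre sums of [B phi] under
    [r |-> r + 1/r] through a product of linear forms; summing over [r + 1/r]
    and applying a Moebius substitution gives the period function on the right,
    up to a constant.  The constant is identified by setting [x = 0].
    Boundary terms survive only for [B = D phi], where they cancel.  At
    [x = -1] the identity reduces to the duplication formula for Jacobi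
    sums. *)

(** * Changes of variable in finite sums *)

Section SumReindexing.
Context {F : finFieldType} {V : nmodType}.
Implicit Types f : F -> V.

Lemma sum_shift (c : F) f : \sum_x f (x + c) = \sum_x f x.
Proof.
rewrite [RHS](reindex (fun x => x + c)) //.
by exists (fun x => x - c) => x _; rewrite ?addrK ?subrK.
Qed.

Lemma sum_scale (c : F) f : c != 0 -> \sum_x f (c * x) = \sum_x f x.
Proof.
move=> c0; rewrite [RHS](reindex (fun x => c * x)) //.
by exists (fun x => c^-1 * x) => x _; rewrite ?mulKf ?mulVKf.
Qed.

Lemma sum_inv f : \sum_x f x^-1 = \sum_x f x.
Proof.
rewrite [RHS](reindex (fun x => x^-1)) //.
by exists (fun x => x^-1) => x _; rewrite invrK.
Qed.

Lemma sum_opp f : \sum_x f (- x) = \sum_x f x.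
Proof.
rewrite [RHS](reindex (fun x => - x)) //.
by exists (fun x => - x) => x _; rewrite opprK.
Qed.

End SumReindexing.

Lemma sum_fiber (I J : finType) (R : pzSemiRingType) (q : I -> J)
    (f : I -> R) (h : J -> R) :
  \sum_i f i * h (q i) = \sum_j (\sum_(i | q i == j) f i) * h j.
Proof.
rewrite (partition_big q xpredT) //=; apply: eq_bigr => j _.
by rewrite mulr_suml; apply: eq_bigr => i /eqP ->.
Qed.

Lemma sum_delta (I : finType) (R : pzSemiRingType) (a : I) (f : I -> R) :
  \sum_i (i == a)%:R * f i = f a.
Proof.
rewrite (bigD1 a) //= eqxx mul1r big1 ?addr0 // => i /negPf ->.
by rewrite mul0r.
Qed.

(** * Multiplicative characters: inversion, unit modulus and orthogonality *)

Section MultiplicativeCharacters.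
Context {F : finFieldType}.
Implicit Types (A E : F -> algC) (x y : F).

Section OneCharacter.
Context {A : F -> algC} (HA : is_mchar A).

Lemma mchar0 : A 0 = 0. Proof. by case: HA. Qed.
Lemma mchar1 : A 1 = 1. Proof. by case: HA. Qed.
Lemma mcharM x y : A (x * y) = A x * A y. Proof. by case: HA. Qed.

Lemma mcharX x n : A (x ^+ n) = A x ^+ n.
Proof. by elim: n => [|n IHn]; rewrite ?expr0 ?mchar1 // !exprS mcharM IHn. Qed.

Lemma mchar_neq0 x : x != 0 -> A x != 0.
Proof.
move=> x0; apply/eqP => Ax0; have := mchar1.
by rewrite -(divff x0) mcharM Ax0 mul0r => /esym/eqP; rewrite oner_eq0.
Qed.

Lemma mcharV x : A x^-1 = (A x)^-1.
Proof.
have [->|x0] := eqVneq x 0; first by rewrite invr0 mchar0 invr0.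
apply: (mulfI (mchar_neq0 _ x0)).
by rewrite -mcharM !divff ?mchar1 // mchar_neq0.
Qed.

(** Since [x ^+ (#|F| - 1) = 1], the values are roots of unity. Conjugation therefore becomes
    inversion, so that later computations with conjugates are left to [field]. *)
Lemma norm_mchar x : x != 0 -> `|A x| = 1.
Proof.
move=> x0; apply/eqP; rewrite -(@pexpr_eq1 _ _ #|F|.-1) //; last first.
  by rewrite -subn1 subn_gt0 finNzRing_gt1.
rewrite -normrX -mcharX -(inj_eq (mulfI (mchar_neq0 _ x0))) mulr1.
have Fx : x ^+ #|F|.-1 = 1.
  apply: (mulfI x0); rewrite -exprS prednK ?expf_card ?mulr1 //.
  by rewrite (ltn_trans _ (finNzRing_gt1 F)).
by rewrite Fx mchar1 normr1 mulr1.
Qed.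

Lemma conj_mchar x : (A x)^* = (A x)^-1.
Proof.
have [->|x0] := eqVneq x 0; first by rewrite mchar0 rmorph0 invr0.
by rewrite invC_norm norm_mchar // expr1n invr1 mul1r.
Qed.

Lemma cconjE x : cconj A x = (A x)^-1.
Proof. exact: conj_mchar. Qed.

Lemma mchar_trivial_or_sum0 :
  (forall x, x != 0 -> A x = 1) \/ \sum_x A x = 0.
Proof.
case: (boolP [forall x, (x != 0) ==> (A x == 1)]) => [/forallP H|].
  by left=> x x0; apply/eqP; move: (H x); rewrite x0.
rewrite negb_forall => /existsP[a]; rewrite negb_imply => /andP[a0 Aa].
right; apply/eqP; have := sum_scale a A a0.
under eq_bigr do rewrite mcharM.
rewrite -mulr_sumr => /eqP; rewrite -subr_eq0 -{2}[\sum_x A x]mul1r -mulrBl.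
by rewrite mulf_eq0 subr_eq0 (negPf Aa).
Qed.

Lemma sum_mchar_trivial :
  (forall x, x != 0 -> A x = 1) -> \sum_x A x = #|F|%:R - 1.
Proof.
move=> A1; rewrite (bigD1 0) //= mchar0 add0r.
rewrite (eq_bigr (fun=> 1)) => [|x x0]; last exact: A1.
rewrite sumr_const cardC1 -subn1 natrB //.
by rewrite (ltn_trans _ (finNzRing_gt1 F)).
Qed.

Lemma sum_mchar_trivial_neq0 :
  (forall x, x != 0 -> A x = 1) -> \sum_x A x != 0.
Proof.
move=> A1; rewrite sum_mchar_trivial // subr_eq0 (eqr_nat _ _ 1).
by rewrite gtn_eqF ?finNzRing_gt1.
Qed.

End OneCharacter.

Lemma mchar_cmul {A E} : is_mchar A -> is_mchar E -> is_mchar (cmul A E).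
Proof.
move=> HA HE; split; rewrite /cmul.
- by rewrite (mchar0 HA) mul0r.
- by rewrite (mchar1 HA) (mchar1 HE) mulr1.
- by move=> x y; rewrite (mcharM HA) (mcharM HE) mulrACA.
Qed.

Lemma mchar_cconj {A} : is_mchar A -> is_mchar (cconj A).
Proof.
move=> HA; split; rewrite ?(cconjE HA).
- by rewrite (mchar0 HA) invr0.
- by rewrite (mchar1 HA) invr1.
- by move=> x y; rewrite !(cconjE HA) (mcharM HA) invfM.
Qed.

End MultiplicativeCharacters.

(** * The quadratic character and Salie-type fibre sums *)

Section OddOrder.
Context {F : finFieldType}.
Hypothesis oddF : odd #|F|.
Implicit Types (A E : F -> algC) (x y s m c : F).

Local Notation phi := (qchar (F := F)).

Lemma two_neq0 : (2%:R : F) != 0.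
Proof.
apply/eqP => F2; have pF : 2 \in [pchar F] by rewrite inE /= F2 eqxx.
move: oddF; rewrite (card_pprimeChar pF) oddX orbF => /eqP n0.
by move: (finNzRing_gt1 F); rewrite (card_pprimeChar pF) n0.
Qed.

Lemma four_neq0 : (4%:R : F) != 0.
Proof. by rewrite (natrM _ 2 2) mulf_neq0 ?two_neq0. Qed.

Lemma qchar0 : phi 0 = 0.
Proof. by rewrite /qchar eqxx. Qed.

Lemma qchar_sqr y : y != 0 -> phi (y ^+ 2) = 1.
Proof.
move=> y0; rewrite /qchar expf_eq0 (negPf y0) /=.
by case: existsP => // -[]; exists y.
Qed.

Lemma qchar_cases x : x != 0 ->
  (exists2 y, y != 0 & x = y ^+ 2 /\ phi x = 1) \/
  ((forall y, y ^+ 2 != x) /\ phi x = -1).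
Proof.
move=> x0; rewrite /qchar (negPf x0); case: existsP => [[y /eqP yx]|N].
  left; exists y => //; by apply/eqP => y0; rewrite -yx y0 expr0n eqxx in x0.
by right; split=> // y; apply/negP => yx; apply: N; exists y.
Qed.

Lemma opp_neq y : y != 0 -> - y != y.
Proof.
by move=> y0; rewrite eq_sym -subr_eq0 opprK -mulr2n -mulr_natl mulf_neq0 ?two_neq0.
Qed.

Lemma sum_sqrt x (f : F -> algC) y : y ^+ 2 = x -> y != 0 ->
  \sum_(r | r ^+ 2 == x) f r = f y + f (- y).
Proof.
move=> <- y0; rewrite (bigD1 y) //= (bigD1 (- y)) /=; last first.
  by rewrite sqrrN eqxx opp_neq.
rewrite big1 ?addr0 // => r.
by rewrite eqf_sqr => /andP[/andP[/orP[->|->]]].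
Qed.

Lemma card_sqrt x : \sum_(r | r ^+ 2 == x) (1 : algC) = 1 + phi x.
Proof.
have [->|x0] := eqVneq x 0.
  rewrite qchar0 addr0 (bigD1 0) //= ?expr0n // big1 ?addr0 // => r.
  by rewrite expf_eq0 /= => /andP[->].
have [[y y0 [xy ->]]|[N ->]] := qchar_cases _ x0.
  by rewrite (sum_sqrt _ _ y).
by rewrite subrr big1 // => r; rewrite (negPf (N r)).
Qed.

(** The sum of [1 + phi x] counts every [r] once, through its square, hence equals the number of
    elements of [F]. *)
Lemma sum_qchar : \sum_x phi x = 0.
Proof.
apply: (@addrI _ (\sum_(x : F) 1)); rewrite addr0 -big_split /=.
under eq_bigr do rewrite -card_sqrt.
rewrite (exchange_big_dep xpredT) //=; apply: eq_bigr => r _.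
by rewrite (big_pred1 (r ^+ 2)) // => x; rewrite eq_sym.
Qed.

Lemma qchar_sqrM y x : y != 0 -> phi (y ^+ 2 * x) = phi x.
Proof.
move=> y0; have [->|x0] := eqVneq x 0; first by rewrite mulr0.
rewrite /qchar mulf_eq0 expf_eq0 (negPf y0) (negPf x0) /=.
congr (if _ then _ else _); apply/existsP/existsP => -[z /eqP zE].
  exists (z / y); rewrite exprMn zE exprVn; apply/eqP; field.
  by [].
by exists (y * z); rewrite exprMn zE.
Qed.

Lemma qchar_le1 x : phi x <= 1.
Proof.
rewrite /qchar; do 2?case: ifP => _; rewrite ?ler01 //.
exact: le_trans (lerN10 _) ler01.
Qed.

Lemma qchar_mchar : is_mchar phi.
Proof.
split; first exact: qchar0.
  by rewrite -(expr1n _ 2) qchar_sqr ?oner_eq0.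
(* Multiplying by a nonsquare a sends squares to nonsquares; as phi sums to 0
   over F, the terms [1 - phi (a * x)] with x a nonsquare must all vanish. *)
move=> a x; have [->|a0] := eqVneq a 0; first by rewrite mul0r qchar0 mul0r.
have [[b b0 [-> ->]]|[_ a1]] := qchar_cases _ a0.
  by rewrite qchar_sqrM // mul1r.
have [->|x0] := eqVneq x 0; first by rewrite mulr0 qchar0 mulr0.
have term y : 0 <= - (phi (a * y) + phi y).
  have [->|y0] := eqVneq y 0; first by rewrite mulr0 qchar0 addr0 oppr0.
  have [[z z0 [yz ->]]|[_ ->]] := qchar_cases _ y0.
    by rewrite yz mulrC qchar_sqrM // a1 addNr oppr0.
  by rewrite opprD opprK addrC subr_ge0 qchar_le1.
have sum0 : \sum_y - (phi (a * y) + phi y) = 0.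
  by rewrite sumrN big_split /= sum_scale // sum_qchar addr0 oppr0.
have /eqP := @psumr_eq0P _ _ xpredT _ (fun y _ => term y) sum0 x isT.
by rewrite oppr_eq0 addr_eq0 => /eqP ->; rewrite a1 mulN1r.
Qed.

Lemma qchar_mulss x : x != 0 -> phi x * phi x = 1.
Proof. by move=> x0; rewrite -(mcharM qchar_mchar) -expr2 qchar_sqr. Qed.

Lemma qcharV x : (phi x)^-1 = phi x.
Proof.
have [->|x0] := eqVneq x 0; first by rewrite qchar0 invr0.
have p0 := mchar_neq0 qchar_mchar _ x0.
by apply: (mulfI p0); rewrite qchar_mulss // divff.
Qed.

(** Such an [A] is trivial on nonzero squares. If [A a != 1], then [a] is a nonsquare, and for every
    other nonsquare [x] the product [a * x] is a square, which forces [A x = A a = -1]. *)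
Lemma mchar_involutive {A} (HA : is_mchar A) :
    (forall x, x != 0 -> A x ^+ 2 = 1) ->
  (forall x, x != 0 -> A x = 1) \/ A =1 phi.
Proof.
move=> A2; case: (boolP [forall x, (x != 0) ==> (A x == 1)]) => [/forallP H|].
  by left=> x x0; apply/eqP; move: (H x); rewrite x0.
rewrite negb_forall => /existsP[a]; rewrite negb_imply => /andP[a0 Aa].
right=> x; have [->|x0] := eqVneq x 0; first by rewrite (mchar0 HA) qchar0.
have [[y y0 [-> ->]]|[_ phix]] := qchar_cases _ x0; first by rewrite (mcharX HA) A2.
have phia : phi a = -1.
  have [[y y0 [ay _]]|[_ //]] := qchar_cases _ a0.
  by rewrite ay (mcharX HA) A2 // eqxx in Aa.
have ax0 : a * x != 0 by rewrite mulf_neq0.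
have Aax : A a * A x = 1.
  have [[y y0 [ay _]]|[_]] := qchar_cases _ ax0.
    by rewrite -(mcharM HA) ay (mcharX HA) A2.
  rewrite (mcharM qchar_mchar) phia phix mulrNN mulr1 => /eqP.
  by rewrite -subr_eq0 opprK -(natrD _ 1 1) pnatr_eq0.
have AaN : A a = -1.
  by have /eqP := A2 _ a0; rewrite sqrf_eq1 (negPf Aa) => /eqP.
by rewrite phix -Aax AaN mulN1r opprK.
Qed.

Lemma card_quadratic s c :
  \sum_(a : F | a ^+ 2 + c == s * a) (1 : algC) = 1 + phi (s ^+ 2 - 4%:R * c).
Proof.
have F2 := two_neq0.
rewrite -card_sqrt (reindex (fun r => (r + s) / 2%:R)) /=; last first.
  by exists (fun a => 2%:R * a - s) => r _; field.
apply: eq_bigl => r; rewrite -subr_eq0 -[RHS]subr_eq0.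
have -> : ((r + s) / 2%:R) ^+ 2 + c - s * ((r + s) / 2%:R)
   = (r ^+ 2 - (s ^+ 2 - 4%:R * c)) / 4%:R by field; rewrite ?four_neq0.
by rewrite mulf_eq0 invr_eq0 (negPf four_neq0) orbF.
Qed.

(** For a nonsquare [c] both sides vanish. For [c = r ^+ 2], [phi] is constant on the roots [a],
    with value [phi (s + 2 r)] when this is nonzero, and the number of roots is read off from the
    discriminant [(s - 2 r) (s + 2 r)]. *)
Lemma salie_fiber s c : c != 0 ->
  \sum_(a | a ^+ 2 + c == s * a) phi a
  = \sum_(r | r ^+ 2 == c) phi (s + 2%:R * r).
Proof.
move=> c0; have F2 := two_neq0; have Hphi := qchar_mchar.
have root0 a : a ^+ 2 + c == s * a -> a != 0.
  by apply: contraTN => /eqP ->; rewrite expr0n mulr0 add0r.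
have [[r r0 [cr _]]|[N c1]] := qchar_cases _ c0; last first.
  rewrite [RHS]big1 => [|r]; last by rewrite (negPf (N r)).
  set X := LHS; have : X = - X; last first.
    move/eqP; rewrite -subr_eq0 opprK -mulr2n -mulr_natl mulf_eq0 pnatr_eq0 /=.
    by move/eqP.
  (* The map [a |-> c / a] exchanges the two roots, whose product is [c], and reverses the sign of
     [phi] because [phi c = -1]. *)
  rewrite /X [LHS](reindex (fun a => c / a)) /=; last first.
    exists (fun a => c / a) => a _; rewrite invfM invrK mulrA divff ?mul1r //.
  rewrite -sumrN; apply: eq_big => a.
    have [->|a0] := eqVneq a 0.
      by rewrite invr0 !mulr0 expr0n.
    rewrite -[LHS](inj_eq (mulfI a0)) -[LHS](inj_eq (mulfI a0)).
    rewrite -[RHS](inj_eq (mulfI c0)).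
    by congr (_ == _); field.
  by move=> _; rewrite (mcharM Hphi) c1 mulN1r (mcharV Hphi) qcharV.
rewrite (sum_sqrt _ _ r) // mulrN.
have sq a : a ^+ 2 + c == s * a -> (a + r) ^+ 2 = a * (s + 2%:R * r).
  by move/eqP => e; rewrite sqrrD -addrA [_ + r ^+ 2]addrC addrA -cr e; ring.
have sqN a : a ^+ 2 + c == s * a -> (a - r) ^+ 2 = a * (s - 2%:R * r).
  by move/eqP => e; rewrite sqrrB -addrA [_ + r ^+ 2]addrC addrA -cr e; ring.
(* When [s] is [- 2 r] or [2 r] the quadratic has a double root, [- r] or [r]. One term on the right
   vanishes and the argument of the other is four times the root. *)
have [sr|sr] := eqVneq (s + 2%:R * r) 0.
  have sE : s = - (2%:R * r) by apply/eqP; rewrite -addr_eq0 sr.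
  rewrite (bigD1 (- r)) /=; last by rewrite cr sE; apply/eqP; ring.
  rewrite big1 => [|a /andP[/sq]]; last first.
    by rewrite sr mulr0 => /eqP; rewrite expf_eq0 /= addr_eq0 => ->.
  rewrite sr qchar0 add0r addr0 sE.
  by rewrite -(qchar_sqrM _ (- r) F2); congr phi; ring.
have [sr'|sr'] := eqVneq (s - 2%:R * r) 0.
  have sE : s = 2%:R * r by apply/eqP; rewrite -subr_eq0 sr'.
  rewrite (bigD1 r) /=; last by rewrite cr sE; apply/eqP; ring.
  rewrite big1 => [|a /andP[/sqN]]; last first.
    by rewrite sr' mulr0 => /eqP; rewrite expf_eq0 /= subr_eq0 => ->.
  rewrite sr' qchar0 !addr0 sE.
  by rewrite -(qchar_sqrM _ r F2); congr phi; ring.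
rewrite (eq_bigr (fun=> 1 * phi (s + 2%:R * r))); last first.
  move=> a Pa; have a0 := root0 _ Pa.
  have ar : a + r != 0.
    apply/eqP => ar; move/eqP: (sq _ Pa); rewrite ar expr0n eq_sym mulf_eq0.
    by rewrite (negPf a0) (negPf sr).
  have := qchar_sqr _ ar; rewrite (sq _ Pa) (mcharM Hphi) => e.
  by rewrite mul1r -[LHS]mulr1 -(qchar_mulss _ sr) mulrA e mul1r.
rewrite -mulr_suml card_quadratic mulrDl mul1r; congr (_ + _).
have -> : s ^+ 2 - 4%:R * c = (s - 2%:R * r) * (s + 2%:R * r) by rewrite cr; ring.
by rewrite (mcharM Hphi) -mulrA qchar_mulss // mulr1.
Qed.

(** Terms are grouped by [s = a + c / a]. The value [a = 0] may lie in different fibres on the two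
    sides, but [phi] vanishes there. *)
Lemma salie_sum c (h : F -> algC) : c != 0 ->
  \sum_a phi a * h (a + c / a)
  = \sum_(r | r ^+ 2 == c) \sum_s phi (s + 2%:R * r) * h s.
Proof.
move=> c0; rewrite (sum_fiber _ _ _ (fun a => a + c / a)) exchange_big /=.
apply: eq_bigr => s _; rewrite -mulr_suml -salie_fiber //; congr (_ * _).
rewrite !(big_mkcond (fun a => _ == _)) /=; apply: eq_bigr => a _.
have [->|a0] := eqVneq a 0; first by rewrite qchar0 !if_same.
by congr (if _ then _ else _); rewrite -[LHS](inj_eq (mulIf a0)); congr (_ == _); field.
Qed.

(* The substitution [r = (a + 1) / (a - 1)] turns the roots of
   [a^2 + 1 = s a] into square roots of [(s + 2) / (s - 2)], to which
   [salie_fiber] applies. *)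
Lemma dihedral_fiber s m :
  \sum_(a | a ^+ 2 + 1 == s * a) phi (a * (a + m))
  = \sum_(z | (2%:R - s) * z ^+ 2 + (4%:R * m + 2%:R * s) * z == 2%:R + s) phi z.
Proof.
have F2 := two_neq0; have Hphi := qchar_mchar.
have F4 := four_neq0.
(* The values [s = 2] and [s = -2] give double roots [a = 1] and [a = -1], where the substitution
   breaks down. For [s = 2] the equation in [z] is linear and has no solution if [m = -1]; for
   [s = -2] it has the root [0], which [phi] ignores. *)
have [->|s2] := eqVneq s 2%:R.
  rewrite (big_pred1 1) => [|a]; last first.
    rewrite -subr_eq0 -[RHS]subr_eq0 -[RHS](expf_eq0 _ 2) //=.
    by congr (_ == 0); ring.
  rewrite mul1r; have [m1|m1] := eqVneq (1 + m) 0.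
    rewrite m1 qchar0 big1 // => z.
    have -> : (2%:R - 2%:R) * z ^+ 2 + (4%:R * m + 2%:R * 2%:R) * z
      = 4%:R * (1 + m) * z by ring.
    by rewrite m1 mulr0 mul0r -natrD eq_sym (negPf F4).
  rewrite (big_pred1 (1 + m)^-1) => [|z]; first by rewrite (mcharV Hphi) qcharV.
  rewrite -[RHS](inj_eq (mulfI m1)) divff // -[RHS](inj_eq (mulfI F4)).
  by congr (_ == _); ring.
have [->|s2'] := eqVneq s (- 2%:R).
  rewrite (big_pred1 (-1)) => [|a]; last first.
    rewrite -subr_eq0 -[RHS]subr_eq0 -[RHS](expf_eq0 _ 2) //=.
    by congr (_ == 0); ring.
  have zE z : ((2%:R - - 2%:R) * z ^+ 2 + (4%:R * m + 2%:R * - 2%:R) * z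
                == 2%:R + - 2%:R) = (z == 0) || (z == 1 - m).
    rewrite -subr_eq0 -[z == 1 - m]subr_eq0 -mulf_eq0.
    by rewrite -[RHS](inj_eq (mulfI F4)) mulr0; congr (_ == _); ring.
  rewrite (eq_bigl _ _ zE).
  have [m1|m1] := eqVneq (1 - m) 0.
    rewrite (big_pred1 0) => [|z]; last by rewrite m1 orbb.
    by congr phi; rewrite -m1; ring.
  rewrite (bigD1 0) ?eqxx //= qchar0 add0r (big_pred1 (1 - m)); last first.
    move=> z; case: (eqVneq z 0) => [->|] /=; last by rewrite andbT.
    by rewrite eq_sym (negPf m1).
  by congr phi; ring.
have sm : s - 2%:R != 0 by rewrite subr_eq0.
have sp : s + 2%:R != 0 by rewrite addr_eq0.
pose c := (s + 2%:R) / (s - 2%:R).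
have c0 : c != 0 by rewrite mulf_neq0 ?invr_eq0.
have c1 : c != 1.
  rewrite -(inj_eq (mulIf sm)) mul1r mulfVK // -subr_eq0.
  by rewrite (_ : _ - _ = 4%:R) //; ring.
transitivity (\sum_(z | z ^+ 2 + c == ((4%:R * m + 2%:R * s) / (s - 2%:R)) * z) phi z);
  last first.
  apply: eq_bigl => z; rewrite -[LHS]subr_eq0 -[RHS]subr_eq0.
  have sN : - (s - 2%:R) != 0 by rewrite oppr_eq0.
  rewrite -[LHS](inj_eq (mulfI sN)) mulr0; congr (_ == _); rewrite /c; field.
  by [].
rewrite salie_fiber //.
pose h a : F := (a + 1) / (a - 1).
have hK a : a != 1 -> h (h a) = a.
  move=> a1; have a1' : a - 1 != 0 by rewrite subr_eq0.
  by rewrite /h; field; rewrite a1' (_ : _ + _ * _ = 2%:R) //; ring.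
rewrite [RHS](reindex_onto h h) => [|r /eqP rc]; last first.
  by rewrite hK //; apply/eqP => r1; rewrite -rc r1 expr1n eqxx in c1.
apply: eq_big => [a|a /eqP aE].
  have [->|a1] := eqVneq a 1.
    have -> : h 1 = 0 by rewrite /h subrr invr0 mulr0.
    rewrite expr0n [0 == c]eq_sym (negPf c0) /=.
    by rewrite mulr1 expr1n -(natrD _ 1 1) eq_sym (negPf s2).
  rewrite hK // eqxx andbT; have a1' : a - 1 != 0 by rewrite subr_eq0.
  rewrite -subr_eq0 -[RHS]subr_eq0 /h /c.
  have -> : ((a + 1) / (a - 1)) ^+ 2 - (s + 2%:R) / (s - 2%:R)
     = (a ^+ 2 + 1 - s * a) * (- 4%:R / ((a - 1) ^+ 2 * (s - 2%:R))).
    by field; rewrite sm a1'.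
  rewrite [RHS]mulf_eq0 [X in _ || X]mulf_eq0 oppr_eq0 (negPf F4) /= invr_eq0.
  by rewrite mulf_eq0 expf_eq0 /= (negPf a1') (negPf sm) !orbF.
have a0 : a != 0.
  by apply/eqP => a0; move/eqP: aE; rewrite a0 expr0n mulr0 add0r oner_eq0.
have sE : s = (a ^+ 2 + 1) / a by rewrite aE mulfK.
have a1 : a - 1 != 0.
  apply: contraNneq s2 => /eqP; rewrite subr_eq0 => /eqP a1.
  by rewrite sE a1 expr1n divr1.
(* Up to a nonzero square, the argument supplied by [salie_fiber] is [a * (a + m)]. *)
have -> : (4%:R * m + 2%:R * s) / (s - 2%:R) + 2%:R * h a
   = (2%:R / (a - 1)) ^+ 2 * (a * (a + m)).
  rewrite /h sE; field; rewrite a0 a1 (_ : _ + _ * _ = (a - 1) ^+ 2) ?expf_neq0 //.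
  by ring.
by rewrite qchar_sqrM // mulf_neq0 ?invr_eq0.
Qed.

End OddOrder.

(** * Jacobi sums and sums along linear forms *)

Section JacobiSums.
Context {F : finFieldType}.
Implicit Types (A E H k : F -> algC) (x y w z : F).

(** The generic case is the substitution [t |-> (w / z) t]. The main term vanishes by itself if [w]
    or [z] is [0], since [0^-1 = 0], so the two degenerate contributions can simply be added. *)
Lemma sum_homogeneous_linear {k H E} (HH : is_mchar H) (HE : is_mchar E)
    (kH : forall a t, a != 0 -> k (a * t) = H a * k t) w z :
  \sum_t k t * E (w + z * t)
  = (\sum_t k t * E (1 + t)) * (H w / H z * E w)
    + (w == 0)%:R * (E z * \sum_t k t * E t)
    + (z == 0)%:R * (E w * \sum_t k t).
Proof.
have [->|z0] := eqVneq z 0.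
  rewrite (mchar0 HH) invr0 mulr0 mul0r mulr0 add0r (mchar0 HE) mul0r mulr0.
  rewrite add0r mul1r mulr_sumr; apply: eq_bigr => t _.
  by rewrite mul0r addr0 mulrC.
rewrite mul0r addr0; have [->|w0] := eqVneq w 0.
  rewrite (mchar0 HE) !mulr0 add0r mul1r mulr_sumr; apply: eq_bigr => t _.
  by rewrite add0r (mcharM HE) mulrCA.
rewrite mul0r addr0 -(sum_scale (w / z)) ?mulf_neq0 ?invr_eq0 //.
rewrite mulr_suml; apply: eq_bigr => t _.
have -> : w + z * (w / z * t) = w * (1 + t) by field.
rewrite kH ?mulf_neq0 ?invr_eq0 // (mcharM HH) (mcharV HH) (mcharM HE); ring.
Qed.

Lemma sum_mchar_linear {A E} (HA : is_mchar A) (HE : is_mchar E) w z :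
  \sum_t A t * E (w + z * t)
  = (\sum_t A t * E (1 + t)) * (A w / A z * E w)
    + (w == 0)%:R * (E z * \sum_t A t * E t)
    + (z == 0)%:R * (E w * \sum_t A t).
Proof. by apply: sum_homogeneous_linear => // a t _; rewrite (mcharM HA). Qed.

Lemma Jac_shift A E : is_mchar A -> \sum_a A a * E (1 + a) = A (-1) * Jac A E.
Proof.
move=> HA; rewrite -sum_opp mulr_sumr; apply: eq_bigr => a _.
by rewrite -[in A (- a)]mulN1r (mcharM HA) mulrA.
Qed.

Lemma Jac_sym A E : Jac A E = Jac E A.
Proof.
rewrite /Jac -sum_opp -(sum_shift (-1)); apply: eq_bigr => x _.
by rewrite mulrC; congr (E _ * A _); ring.
Qed.

(* [|Jac A E|^2] is [#|F|] or [1] when both characters are nontrivial. *)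
Lemma Jac_neq0 {A E} : is_mchar A -> is_mchar E -> \sum_x E x = 0 -> Jac A E != 0.
Proof.
move=> HA HE E0.
(* For trivial [A], the Jacobi sum is a vanishing complete sum without its term [E 1 = 1], hence
   [-1]. *)
have [A1|A0] := mchar_trivial_or_sum0 HA.
  rewrite /Jac (_ : \sum__ _ = - 1) ?oppr_eq0 ?oner_eq0 //.
  have : \sum_x E (1 - x) = 0.
    rewrite -[RHS]E0 -(sum_shift 1 E) -(sum_opp (fun x => E (x + 1))).
    by apply: eq_bigr => x _; rewrite addrC.
  rewrite (bigD1 0) //= subr0 (mchar1 HE) => /eqP; rewrite addrC addr_eq0 => /eqP <-.
  rewrite (bigD1 0) //= (mchar0 HA) mul0r add0r; apply: eq_bigr => x x0.
  by rewrite A1 // mul1r.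
suff e : Jac A E * (Jac A E)^* = #|F|%:R - \sum_x A x * E x.
  have ne : #|F|%:R - \sum_x A x * E x != 0.
    have [AE1|AE0] := mchar_trivial_or_sum0 (mchar_cmul HA HE).
      by rewrite (sum_mchar_trivial (mchar_cmul HA HE)) // opprB addrC subrK oner_eq0.
    rewrite (_ : \sum__ _ = 0) ?subr0 ?pnatr_eq0 -?lt0n //.
    by rewrite (ltn_trans _ (finNzRing_gt1 F)).
  by apply: contraNneq ne => J0; rewrite -e J0 mul0r.
rewrite /Jac rmorph_sum mulr_sumr /=.
have row (y : F) : y != 0 -> y != 1 ->
    (\sum_x A x * E (1 - x)) * (A y * E (1 - y))^* =
    \sum_t A t * E ((1 - t * y) / (1 - y)).
  move=> y0 y1; have y1' : 1 - y != 0 by rewrite subr_eq0 eq_sym.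
  rewrite -(sum_scale y) // mulr_suml; apply: eq_bigr => t _.
  rewrite rmorphM /= (conj_mchar HA) (conj_mchar HE).
  rewrite !(mcharM HA) !(mcharM HE) (mcharV HE).
  rewrite [y * t]mulrC; field.
  by rewrite !mchar_neq0.
rewrite (bigD1 0) //= (mchar0 HA) mul0r rmorph0 mulr0 add0r.
rewrite (bigD1 1) ?oner_eq0 //= subrr (mchar0 HE) mulr0 rmorph0 mulr0 add0r.
rewrite (eq_bigr (fun y => \sum_t A t * E ((1 - t * y) / (1 - y)))); last first.
  by move=> y /andP[y0 y1]; rewrite row.
rewrite exchange_big /=.
have col (t : F) : \sum_(y | (y != 0) && (y != 1)) A t * E ((1 - t * y) / (1 - y))
   = (t == 1)%:R * (#|F|%:R * A t) - A t - A t * E t.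
  rewrite -mulr_sumr; have [->|t1] := eqVneq t 1.
    rewrite (eq_bigr (fun=> 1)) => [|y /andP[_ y1]]; last first.
      by rewrite mul1r divff ?(mchar1 HE) // subr_eq0 eq_sym.
    have : \sum_(y : F) (1 : algC) = #|F|%:R by rewrite sumr_const.
    rewrite (bigD1 0) //= (bigD1 1) ?oner_eq0 //= => <-.
    rewrite (mchar1 HA) (mchar1 HE); ring.
  have t1' : t - 1 != 0 by rewrite subr_eq0.
  suff -> : \sum_(y | (y != 0) && (y != 1)) E ((1 - t * y) / (1 - y)) = - 1 - E t.
    by rewrite mul0r; ring.
  have := E0; rewrite (bigD1 1) //= (mchar1 HE) (bigD1 t) //= => /eqP.
  rewrite addrA addrC addr_eq0 opprD => /eqP <-.
  (* This Moebius map sends [0] to [1] and infinity to [t]. Removing [0] and the pole [1] thus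
     leaves a bijection onto the elements other than [1] and [t]. *)
  rewrite [RHS](reindex_onto (fun y => (1 - t * y) / (1 - y))
    (fun r => (1 - r) / (t - r))) /=.
    apply: eq_bigl => y; have [->|y1] := eqVneq y 1.
      by rewrite subrr invr0 mulr0 !subr0 div1r invr_eq1 (negPf t1) !andbF.
    have y1' : 1 - y != 0 by rewrite subr_eq0 eq_sym.
    have -> : t - (1 - t * y) / (1 - y) = (t - 1) / (1 - y) by field.
    have -> : 1 - (1 - t * y) / (1 - y) = y * (t - 1) / (1 - y) by field.
    have -> : y * (t - 1) / (1 - y) / ((t - 1) / (1 - y)) = y by field; rewrite y1' t1'.
    rewrite eqxx !andbT -[_ == t]subr_eq0 -[_ / _ == 1]subr_eq0.
    have -> : (1 - t * y) / (1 - y) - 1 = - y * (t - 1) / (1 - y) by field.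
    have -> : (1 - t * y) / (1 - y) - t = - (t - 1) / (1 - y) by field.
    by rewrite !mulf_eq0 !oppr_eq0 invr_eq0 (negPf y1') (negPf t1') !orbF andbT.
  move=> r /andP[r1 rt]; have rt' : t - r != 0 by rewrite subr_eq0 eq_sym.
  by field; rewrite rt' (_ : t - r - (1 - r) = t - 1) //; ring.
under eq_bigr do rewrite col.
rewrite !sumrB sum_delta A0 (mchar1 HA) subr0; ring.
Qed.

End JacobiSums.

(** * Duplication formula, Salie double sum and dihedral sum *)

Section QuadraticIdentities.
Context {F : finFieldType}.
Hypothesis oddF : odd #|F|.
Implicit Types (A E W k g : F -> algC) (x y s m c w z nu lam : F).

Local Notation phi := (qchar (F := F)).
Let Hphi := qchar_mchar oddF.
Let F2 := two_neq0 oddF.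
Let F4 := four_neq0 oddF.

(** The left side is the double sum of [A v * A a * E (1 - v - a)]. With [s = v + a] fixed, the
    number of [a] with [a (s - a) = p] is [1 + phi (s^2 - 4 p)]. The constant [1] contributes a
    product of complete sums, which is [0]; the other part gives [Jac A phi] times [A (s^2 / 4)]. *)
Lemma Jac_duplication {A E} (HA : is_mchar A) (HE : is_mchar E) :
    \sum_x A x * E x = 0 -> \sum_x A x * phi x = 0 ->
  Jac A E * Jac A (cmul A E) = Jac (cmul A A) E * (Jac A phi / A 4%:R).
Proof.
move=> AE0 Aphi0.
have A0E0 : (\sum_x A x) * (\sum_x E x) = 0.
  have [A1|->] := mchar_trivial_or_sum0 HA; last by rewrite mul0r.
  suff -> : \sum_x E x = \sum_x A x * E x by rewrite AE0 mulr0.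
  apply: eq_bigr => x _.
  have [->|x0] := eqVneq x 0; first by rewrite (mchar0 HA) (mchar0 HE) mul0r.
  by rewrite A1 // mul1r.
transitivity (\sum_v A v * \sum_a A a * E (1 - (v + a))).
  rewrite mulrC /Jac /cmul mulr_suml; apply: eq_bigr => v _.
  (* The rescaling of [a] by [1 - v] fails at [v = 1], where the inner sum is a multiple of the sum
     of [A * E], assumed to be [0]. *)
  have [->|v1] := eqVneq v 1.
    rewrite subrr (mchar0 HA) mul0r mulr0 mul0r.
    rewrite (eq_bigr (fun a => E (-1) * (A a * E a))) => [|a _]; last first.
      by rewrite (_ : 1 - (1 + a) = -1 * a) ?(mcharM HE) 1?mulrCA //; ring.
    by rewrite -mulr_sumr AE0 !mulr0.
  have v1' : 1 - v != 0 by rewrite subr_eq0 eq_sym.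
  rewrite -mulrA; congr (_ * _).
  rewrite mulr_sumr -[RHS](sum_scale (1 - v)) //; apply: eq_bigr => u _.
  rewrite (_ : 1 - (v + (1 - v) * u) = (1 - v) * (1 - u)); last by ring.
  by rewrite (mcharM HA) (mcharM HE); ring.
transitivity (\sum_s E (1 - s) * \sum_a A (a * (s - a))).
  under eq_bigr do rewrite mulr_sumr.
  rewrite exchange_big /=.
  under [RHS]eq_bigr do rewrite mulr_sumr.
  rewrite [RHS]exchange_big /=; apply: eq_bigr => a _.
  rewrite -[RHS](sum_shift a); apply: eq_bigr => v _.
  by rewrite addrK (mcharM HA); ring.
transitivity (\sum_s (E (1 - s) * \sum_p A p +
   E (1 - s) * \sum_p A p * phi (s ^+ 2 + (- 4%:R) * p))).
  apply: eq_bigr => s _; rewrite -mulrDr; congr (_ * _).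
  rewrite -big_split /=.
  rewrite (eq_bigr (fun a => 1 * A (a * (s - a)))) => [|a _]; last by rewrite mul1r.
  rewrite (sum_fiber _ _ _ (fun a => a * (s - a)) (fun=> 1)); apply: eq_bigr => p _.
  rewrite mulNr -[A p in RHS]mulr1 -mulrA -mulrDr mul1r -card_quadratic // mulrC.
  congr (_ * _).
  apply: eq_bigl => a; rewrite -subr_eq0 -[RHS]subr_eq0 -[RHS]oppr_eq0.
  by congr (_ == 0); ring.
rewrite big_split /= -mulr_suml.
have -> : \sum_s E (1 - s) = \sum_s E s.
  rewrite -[RHS](sum_shift 1) -[RHS]sum_opp.
  by apply: eq_bigr => s _; rewrite addrC.
rewrite mulrC A0E0 add0r /Jac mulr_suml; apply: eq_bigr => s _.
rewrite (sum_mchar_linear HA Hphi) Aphi0 oppr_eq0 (negPf F4) !mulr0 mul0r !addr0.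
rewrite (Jac_shift _ _ HA) /cmul.
have [->|s0] := eqVneq s 0.
  by rewrite expr0n (mchar0 HA) !mul0r !mulr0.
rewrite qchar_sqr // -[- 4%:R]mulN1r (mcharX HA) !(mcharM HA) /Jac.
by field; rewrite !(mchar_neq0 HA) // oppr_eq0 oner_eq0.
Qed.

Lemma Salie_double_sum {A W} (HA : is_mchar A) nu : nu != 0 ->
  \sum_b A b * \sum_a A a * phi a * W (1 + a * b + a + nu ^+ 2 * b)
  = \sum_r A r ^+ 2 * \sum_v phi v * W (1 + r ^+ 2 - 2%:R * nu * r + v).
Proof.
move=> nu0.
transitivity (\sum_p A p * \sum_a phi a * W (1 + p + (a + nu ^+ 2 * p / a))).
  under eq_bigr do rewrite mulr_sumr.
  under [RHS]eq_bigr do rewrite mulr_sumr.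
  rewrite exchange_big /= [RHS]exchange_big /=; apply: eq_bigr => a _.
  have [->|a0] := eqVneq a 0.
    by rewrite qchar0 !big1 // => b _; rewrite ?mul0r !(mulr0, mul0r).
  rewrite -[RHS](sum_scale a) //; apply: eq_bigr => b _.
  rewrite (mcharM HA); have -> : nu ^+ 2 * (a * b) / a = nu ^+ 2 * b by field.
  by rewrite !addrA; ring.
transitivity (\sum_p \sum_(r | r ^+ 2 == nu ^+ 2 * p)
   A p * \sum_s phi (s + 2%:R * r) * W (1 + p + s)).
  apply: eq_bigr => p _; have [->|p0] := eqVneq p 0.
    by rewrite (mchar0 HA) mul0r big1 // => r _; rewrite mul0r.
  rewrite (salie_sum oddF (nu ^+ 2 * p) (fun t => W (1 + p + t))) ?mulr_sumr //.
  by rewrite mulf_neq0 ?expf_neq0.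
(* Scaling [r] by [nu] turns the fibre condition into [p = r ^+ 2], which leaves a single [p] for
   each [r]. *)
rewrite (exchange_big_dep xpredT) //= -(sum_scale nu) //; apply: eq_bigr => r _.
rewrite (big_pred1 (r ^+ 2)) => [|p]; last first.
  rewrite exprMn (inj_eq (mulfI _)) ?expf_neq0 //; exact: eq_sym.
rewrite (mcharX HA) -(sum_shift (- (2%:R * nu * r))); congr (_ * _).
apply: eq_bigr => s _; rewrite mulrA subrK.
by congr (_ * W _); ring.
Qed.

(** The auxiliary first factor brings in [m = r * e], through which [E e * E r * phi (1 + e)]
    becomes [E m * phi (r * (r + m))]. After [dihedral_fiber] the equation relating [z], [s] and [m]
    is linear in [m], so the sum over [m] reduces to one value of [E], which factors into linear
    forms. *)
Lemma dihedral_sum {E} (HE : is_mchar E) g :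
  (\sum_e E e * phi (1 + e)) * (\sum_r E r * g (r + r^-1))
  = \sum_z phi z * E ((1 - z) / (4%:R * z)) *
      \sum_s g s * E (2%:R * (1 + z) + s * (1 - z)).
Proof.
transitivity (\sum_m E m * \sum_r phi (r * (r + m)) * g (r + r^-1)).
  under [RHS]eq_bigr do rewrite mulr_sumr.
  rewrite [RHS]exchange_big /= mulr_sumr; apply: eq_bigr => r _.
  have [->|r0] := eqVneq r 0.
    rewrite (mchar0 HE) mul0r mulr0 big1 // => m _.
    by rewrite mul0r qchar0 mul0r mulr0.
  rewrite -[RHS](sum_scale r) // mulr_suml; apply: eq_bigr => m _.
  have -> : r * (r + r * m) = r ^+ 2 * (1 + m) by ring.
  by rewrite qchar_sqrM // (mcharM HE); ring.
transitivity (\sum_m E m * \sum_s (\sum_(z | (2%:R - s) * z ^+ 2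
     + (4%:R * m + 2%:R * s) * z == 2%:R + s) phi z) * g s).
  apply: eq_bigr => m _; congr (_ * _).
  rewrite (sum_fiber _ _ _ (fun r => r + r^-1)); apply: eq_bigr => s _.
  rewrite -dihedral_fiber //; congr (_ * _).
  rewrite big_mkcond [RHS]big_mkcond; apply: eq_bigr => r _.
  have [->|r0] := eqVneq r 0; first by rewrite mul0r qchar0 !if_same.
  congr (if _ then _ else _); rewrite -[LHS](inj_eq (mulIf r0)).
  by congr (_ == _); field.
transitivity (\sum_z phi z * \sum_s g s * E ((1 - z) / (4%:R * z)
     * (2%:R * (1 + z) + s * (1 - z)))); last first.
  apply: eq_bigr => z _; rewrite -mulrA; congr (_ * _); rewrite mulr_sumr.
  by apply: eq_bigr => s _; rewrite (mcharM HE) mulrCA.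
under eq_bigr do rewrite mulr_sumr.
rewrite exchange_big /=.
under [RHS]eq_bigr do rewrite mulr_sumr.
rewrite [RHS]exchange_big /=; apply: eq_bigr => s _.
under eq_bigr do rewrite mulr_suml mulr_sumr.
rewrite (exchange_big_dep xpredT) //=; apply: eq_bigr => z _.
have [->|z0] := eqVneq z 0.
  by rewrite qchar0 [RHS]mul0r big1 // => m _; rewrite mul0r mulr0.
rewrite (big_pred1 ((1 - z) / (4%:R * z) * (2%:R * (1 + z) + s * (1 - z)))).
  by rewrite mulrC mulrA.
move=> m; have z4 : 4%:R * z != 0 by rewrite mulf_neq0.
rewrite -[RHS](inj_eq (mulIf z4)) -subr_eq0 -[RHS]subr_eq0.
by congr (_ == 0); field; rewrite z0 F4.
Qed.

End QuadraticIdentities.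

(** * Integral-type transformations of the period function *)

Section PeriodFunctions.
Context {F : finFieldType}.
Implicit Types (A B C E : F -> algC) (x y lam mu : F).

Lemma P21_0 {A B C} (HA : is_mchar A) :
  P21 A B C 0 = Jac B (cmul C (cconj B)).
Proof.
apply: eq_bigr => y _.
by rewrite mul0r subr0 (cconjE HA) (mchar1 HA) invr1 mulr1 /cmul [C _ * _]mulrC.
Qed.

(** The substitution [y = b / (1 + b)] makes [lam] enter only through [1 - lam], the quantity that
    is a square in the application. *)
Lemma P21_affine {A B C} (HA : is_mchar A) (HB : is_mchar B) (HC : is_mchar C) lam :
  P21 A B C lam
  = \sum_b B b * (A (1 + b) / A (1 + (1 - lam) * b) / C (1 + b)).
Proof.
rewrite /P21 (bigID (pred1 1)) /= big_pred1_eq subrr /cmul (mchar0 HC).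
rewrite mulr0 mulr0 mul0r add0r.
rewrite [RHS](bigID (pred1 (-1))) /= big_pred1_eq subrr (mchar0 HA).
rewrite !mul0r mulr0 add0r.
rewrite (reindex_onto (fun b => b / (1 + b)) (fun y => y / (1 - y))) /=; last first.
  move=> y y1; have y1' : 1 - y != 0 by rewrite subr_eq0 eq_sym.
  by field; rewrite y1' subrK oner_eq0.
apply: eq_big => b.
  have [->|b1] := eqVneq b (-1).
    by rewrite subrr invr0 mulr0 mul0r [0 == -1]eq_sym oppr_eq0 oner_eq0 andbF.
  have b1' : 1 + b != 0 by rewrite addrC addr_eq0.
  have -> : b / (1 + b) / (1 - b / (1 + b)) = b by field; rewrite b1' addrK oner_eq0.
  rewrite eqxx andbT -subr_eq0.
  have -> : b / (1 + b) - 1 = - (1 + b)^-1 by field.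
  by rewrite oppr_eq0 invr_eq0.
case/andP=> b1 bK.
have b1' : 1 + b != 0.
  apply: contraTneq bK => e; rewrite e invr0 mulr0 mul0r eq_sym.
  by apply: contra_eqN e => /eqP ->; rewrite addr0 oner_eq0.
rewrite (cconjE HA) (cconjE HB).
have -> : 1 - b / (1 + b) = (1 + b)^-1 by field.
have -> : 1 - lam * (b / (1 + b)) = (1 + (1 - lam) * b) / (1 + b) by field.
rewrite (mcharM HA) (mcharV HA) (mcharM HB) (mcharV HB) (mcharV HC).
rewrite !invfM !invrK; set X := (A (1 + (1 - lam) * b))^-1; move: X => X.
by field; rewrite !(mchar_neq0 HA, mchar_neq0 HB, mchar_neq0 HC).
Qed.

(** The sum over [a] is evaluated by [sum_mchar_linear]. The contribution of [1 + b = 0] carries the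
    sum of [A / C] and drops out; that of [1 + mu b = 0] survives as the last term. *)
Lemma P21_double_sum {A B C} (HA : is_mchar A) (HB : is_mchar B) (HC : is_mchar C)
    mu : mu != 0 -> \sum_a A a / C a = 0 ->
  \sum_b B b * \sum_a A a / C (1 + b + (1 + mu * b) * a)
  = (\sum_a A a / C (1 + a)) * P21 A B C (1 - mu)
    + (\sum_a A a) * (B (- mu^-1) / C (1 - mu^-1)).
Proof.
move=> mu0 AC0.
under eq_bigr => b _ do under eq_bigr do rewrite -(cconjE HC).
under eq_bigr => b _ do rewrite (sum_mchar_linear HA (mchar_cconj HC)).
under [X in _ = X * _ + _]eq_bigr do rewrite -(cconjE HC).
have -> : \sum_t A t * cconj C t = 0 by under eq_bigr do rewrite (cconjE HC).
rewrite (P21_affine HA HB HC) mulr_sumr subKr.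
transitivity (\sum_b ((\sum_t A t * cconj C (1 + t)) *
   (B b * (A (1 + b) / A (1 + mu * b) / C (1 + b)))
   + (b == - mu^-1)%:R * ((\sum_a A a) * (B b / C (1 + b))))).
  apply: eq_bigr => b _; rewrite !mulr0 addr0 (cconjE HC).
  have -> : (1 + mu * b == 0) = (b == - mu^-1).
    rewrite -[RHS](inj_eq (mulfI mu0)) mulrN divff // addrC addr_eq0.
    by [].
  by ring.
by rewrite big_split /= sum_delta.
Qed.

(** The left side is the period function with upper parameters [C / B^2], [1 / B] and lower
    parameter [C / B], so this is an Euler-type transformation. It comes from the Moebius involution
    [h], which swaps [0] with [1] and, for [x != 0], [1 / x] with infinity. *)
Lemma P21_Pfaff {B C} (HB : is_mchar B) (HC : is_mchar C) x : x != 1 ->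
  \sum_z C (1 - z) / B z * B (1 - x * z) ^+ 2 / C (1 - x * z)
  = B (1 - x) ^+ 2 * P21 B C (cmul C (cconj B)) x.
Proof.
move=> x1; have x1' : 1 - x != 0 by rewrite subr_eq0 eq_sym.
rewrite /P21 mulr_sumr (bigID (fun z => 1 - x * z == 0)) /= big1;
  last by move=> z /eqP ->; rewrite (mchar0 HB) expr0n mulr0 mul0r.
rewrite [RHS](bigID (fun z => 1 - x * z == 0)) /= [X in _ = X + _]big1;
  last by move=> z /eqP ->; rewrite (cconjE HB) (mchar0 HB) invr0 !mulr0.
rewrite !add0r.
pose h y := (1 - y) / (1 - x * y).
have hh y : 1 - x * y != 0 -> (1 - x * h y = (1 - x) / (1 - x * y)) * (h (h y) = y).
  by move=> y0; rewrite /h; split; field; rewrite ?y0 //= (_ : _ + _ = 1 - x) //; ring.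
rewrite (reindex_onto h h) => [|y y0]; last by rewrite hh.
apply: eq_big => y.
  have [y0|y0] := eqVneq (1 - x * y) 0; last first.
    by rewrite !hh // eqxx andbT mulf_neq0 ?invr_eq0.
  rewrite /h y0 invr0 !mulr0 !subr0 invr1 mulr1 oner_eq0 /=.
  by apply: contra_eqF y0 => /eqP <-; rewrite mulr1.
case/andP=> hy0 hy.
have y0 : 1 - x * y != 0.
  apply: contraTneq hy => y0; rewrite /h y0 invr0 !mulr0 !subr0 invr1 mulr1.
  by apply: contra_eqN y0 => /eqP <-; rewrite mulr1.
rewrite hh //; have -> : 1 - h y = y * (1 - x) / (1 - x * y) by rewrite /h; field.
have [->|y1] := eqVneq y 1.
  rewrite subrr /cmul (cconjE HB) /h subrr mul0r (mchar0 HB).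
  by rewrite (cconjE HC) (mchar0 HC) !(mulr0, mul0r, invr0).
have y1' : 1 - y != 0 by rewrite subr_eq0 eq_sym.
rewrite /h /cmul (cconjE HC) !(cconjE HB) !(mcharM HC) !(mcharM HB).
rewrite !(mcharV HC) !(mcharV HB).
by field; rewrite !(mchar_neq0 HB, mchar_neq0 HC).
Qed.

End PeriodFunctions.

(** * The quadratic transformation for [x != 1] *)

Section QuadraticTransformation.
Context {F : finFieldType}.
Hypothesis oddF : odd #|F|.
Local Notation phi := (qchar (F := F)).
Let Hphi := qchar_mchar oddF.
Let F2 := two_neq0 oddF.
Let F4 := four_neq0 oddF.

Context {B D : F -> algC} (HB : is_mchar B) (HD : is_mchar D).
(** The conditions [D <> phi] and [B <> D] are expressed by orthogonality, as nontriviality of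
    [D * phi] and of [D / B]. *)
Hypothesis Dphi0 : \sum_t D t * phi t = 0.
Hypothesis DB0 : \sum_t D t / B t = 0.

Local Notation C := (cmul D D).
Local Notation CB := (cmul C (cconj B)).
Local Notation A := (cmul (cmul D phi) (cconj B)).
Local Notation E := (cmul B phi).
Local Notation W := (cconj CB).
Local Notation H := (cmul phi W).

Let HC := mchar_cmul HD HD.
Let HCB := mchar_cmul HC (mchar_cconj HB).
Let HA := mchar_cmul (mchar_cmul HD Hphi) (mchar_cconj HB).
Let HE := mchar_cmul HB Hphi.
Let HW := mchar_cconj HCB.
Let HH := mchar_cmul Hphi HW.

Let AE t : A t = D t * phi t / B t.
Proof. by rewrite /cmul (cconjE HB). Qed.

Let WE t : W t = B t / D t ^+ 2.
Proof. by rewrite (cconjE HCB) /cmul (cconjE HB) !invfM invrK mulrC. Qed.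

Let EE t : E t = B t * phi t. Proof. by []. Qed.

Let HtE t : H t = phi t * W t. Proof. by []. Qed.

(** Off [0] this is a constant multiple of [H]. The value at [0] is the complete sum of [H], which
    is nonzero for trivial [H], so [kernel] cannot be replaced by that multiple. *)
Definition kernel t := \sum_v phi v * W (t + v).

Let kernel_homogeneous a t : a != 0 -> kernel (a * t) = H a * kernel t.
Proof.
move=> a0; rewrite /kernel mulr_sumr -(sum_scale a) //; apply: eq_bigr => v _.
by rewrite -mulrDr (mcharM Hphi) (mcharM HW) /cmul mulrACA.
Qed.

Definition double_period nu :=
  \sum_b D b * \sum_a A a / CB (1 + b + (1 + nu ^+ 2 * b) * a).

Lemma double_period_P21 nu : nu != 0 ->
  double_period nu = (\sum_a A a / CB (1 + a)) * P21 A D CB (1 - nu ^+ 2)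
    + (\sum_a A a) * (D (- (nu ^+ 2)^-1) / CB (1 - (nu ^+ 2)^-1)).
Proof.
move=> nu0; apply: P21_double_sum => //; first by rewrite expf_neq0.
(* Off [0], [A / CB] equals [phi / D], the conjugate of [D * phi]. *)
transitivity ((\sum_t D t * phi t)^*); last by rewrite Dphi0 rmorph0.
rewrite rmorph_sum; apply: eq_bigr => t _.
rewrite rmorphM /= (conj_mchar HD) (conj_mchar Hphi) qcharV //.
have [->|t0] := eqVneq t 0.
  by rewrite AE (mchar0 HD) qchar0 !(mulr0, mul0r).
rewrite -(cconjE HCB) AE WE; field.
by rewrite !(mchar_neq0 HD, mchar_neq0 HB).
Qed.

Lemma double_period_dihedral nu : nu != 0 ->
  double_period nu = \sum_r E r * kernel (r + r^-1 - 2%:R * nu).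
Proof.
move=> nu0.
transitivity (\sum_b D b * \sum_a D a * phi a * W (1 + a * b + a + nu ^+ 2 * b)).
  apply: eq_bigr => b _; congr (_ * _); rewrite -sum_inv; apply: eq_bigr => a _.
  have [->|a0] := eqVneq a 0.
    by rewrite invr0 (mchar0 HA) (mchar0 HD) !mul0r.
  have -> : 1 + b + (1 + nu ^+ 2 * b) / a = (1 + a * b + a + nu ^+ 2 * b) / a.
    by field.
  rewrite -(cconjE HCB) (mcharM HW) (mcharV HW) (mcharV HA) AE (WE a).
  have phia : (phi a)^-1 = phi a by rewrite qcharV.
  rewrite -[in RHS]phia; field.
  by rewrite !(mchar_neq0 HD, mchar_neq0 HB, mchar_neq0 Hphi).
rewrite (Salie_double_sum oddF HD) //; apply: eq_bigr => r _.
have [->|r0] := eqVneq r 0.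
  by rewrite (mchar0 HE) (mchar0 HD) expr0n !mul0r.
have -> : \sum_v phi v * W (1 + r ^+ 2 - 2%:R * nu * r + v)
   = kernel (r * (r + r^-1 - 2%:R * nu)).
  by rewrite /kernel; apply: eq_bigr => v _; congr (_ * W (_ + _)); field.
(* Homogeneity contributes [H r], and [D r ^+ 2 * H r = E r]. *)
rewrite kernel_homogeneous // mulrA; congr (_ * _); rewrite /cmul WE; field.
by rewrite (mchar_neq0 HD).
Qed.

Let sum_kernelE : \sum_t kernel t * E t = kernel 1 * \sum_t H t * E t.
Proof.
rewrite mulr_sumr; apply: eq_bigr => t _.
have [->|t0] := eqVneq t 0; first by rewrite (mchar0 HE) !mulr0.
have -> : kernel t = H t * kernel 1 by rewrite -kernel_homogeneous // mulr1.
by rewrite mulrA [_ * kernel 1]mulrC.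
Qed.

Lemma dihedral_P21 x : x != 1 ->
  (\sum_e E e * phi (1 + e)) *
    (\sum_r E r * kernel (r + r^-1 - 2%:R * ((1 + x) / (1 - x))))
  = (\sum_t kernel t * E (1 + t)) *
      (B 4%:R / D 4%:R ^+ 2 * (D (1 - x) ^+ 2 * P21 B C CB x))
    + (\sum_t H t * E t) * (kernel 1 * B ((1 - x) ^+ 2 / (4%:R * x))).
Proof.
move=> x1; have x1' : 1 - x != 0 by rewrite subr_eq0 eq_sym.
rewrite (dihedral_sum oddF HE (fun s => kernel (s - 2%:R * ((1 + x) / (1 - x))))).
(* This is the constant term of [2 (1 + z) + s (1 - z)] after the shift
   [s = t + 2 (1 + x) / (1 - x)]. *)
pose w z := 4%:R * (1 - x * z) / (1 - x).
(* The second summand is the degenerate contribution of [w z = 0], that is [z = 1 / x]. The guard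
   [x != 0] is there because [0^-1 = 0] would otherwise select [z = 0]. *)
transitivity (\sum_z ((\sum_t kernel t * E (1 + t)) * (B 4%:R / D 4%:R ^+ 2 *
    ((D (1 - x) / B (1 - x)) ^+ 2 *
      (C (1 - z) / B z * B (1 - x * z) ^+ 2 / C (1 - x * z))))
   + ((x != 0) && (z == x^-1))%:R *
     ((\sum_t H t * E t) * (kernel 1 * B ((1 - x) ^+ 2 / (4%:R * x)))))).
  apply: eq_bigr => z _.
  have [->|z0] := eqVneq z 0.
    rewrite qchar0 !mul0r (mchar0 HB) invr0 !(mulr0, mul0r) add0r.
    by rewrite [0 == _]eq_sym invr_eq0 andNb mul0r.
  have [->|z1] := eqVneq z 1.
    rewrite subrr mul0r (mchar0 HE) (mchar0 HC) !(mulr0, mul0r) add0r.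
    by rewrite [1 == _]eq_sym invr_eq1 (negPf x1) andbF mul0r.
  have z1' : 1 - z != 0 by rewrite subr_eq0 eq_sym.
  rewrite (_ : \sum_s _ = \sum_t kernel t * E (w z + (1 - z) * t)); last first.
    rewrite -(sum_shift (2%:R * ((1 + x) / (1 - x)))); apply: eq_bigr => t _.
    by rewrite addrK; congr (_ * E _); rewrite /w; field.
  rewrite (sum_homogeneous_linear HH HE kernel_homogeneous) (negPf z1') mul0r addr0 mulrDr.
  congr (_ + _).
    have [xz0|xz0] := eqVneq (1 - x * z) 0.
      by rewrite /w xz0 mulr0 mul0r (mchar0 HH) (mchar0 HB) expr0n !(mul0r, mulr0).
    have w0 : w z != 0 by rewrite !mulf_neq0 ?invr_eq0.
    have pz : phi ((1 - z) / (4%:R * z)) = phi (1 - z) * phi z.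
      rewrite -(mcharM Hphi) -[RHS](qchar_sqrM _ _ (invr_neq0 (mulf_neq0 F2 z0))).
      by congr phi; field; rewrite F4 z0 F2.
    (* The values of [phi] pair off into squares, leaving only [B] and [D]. *)
    transitivity (phi z * phi z * (phi (w z) * phi (w z)) *
       (B ((1 - z) / (4%:R * z)) * ((\sum_t kernel t * E (1 + t)) *
         (W (w z) / W (1 - z) * B (w z))))).
      rewrite !EE !HtE pz; field.
      by rewrite (mchar_neq0 Hphi) // (mchar_neq0 HW).
    rewrite !qchar_mulss // mul1r mul1r !WE /w /cmul.
    rewrite !(mcharM HB) !(mcharM HD) !(mcharV HB) !(mcharV HD) !(mcharM HB).
    by field; rewrite !(mchar_neq0 HD, mchar_neq0 HB).
  have -> : (w z == 0) = (x != 0) && (z == x^-1).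
    rewrite /w !mulf_eq0 invr_eq0 (negPf F4) (negPf x1') orbF /=.
    have [->|x0] := eqVneq x 0; first by rewrite mul0r subr0 oner_eq0.
    by rewrite subr_eq0 -[RHS](inj_eq (mulfI x0)) divff // eq_sym.
  case: (boolP (_ && _)) => [/andP[x0 /eqP zx]|_]; last by rewrite !mul0r mulr0.
  rewrite !mul1r sum_kernelE.
  transitivity (phi z * phi ((1 - z) / (4%:R * z)) * phi (1 - z) *
     (B ((1 - z) / (4%:R * z)) * B (1 - z) * ((\sum_t H t * E t) * kernel 1))).
    by rewrite !EE; ring.
  rewrite -!(mcharM Hphi) -(mcharM HB).
  have -> : z * ((1 - z) / (4%:R * z)) * (1 - z) = ((1 - z) / 2%:R) ^+ 2.
    by field; rewrite F4 z0 F2.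
  have -> : (1 - z) / (4%:R * z) * (1 - z) = (1 - x) ^+ 2 / (4%:R * x).
    by rewrite zx; field; rewrite F4 x0.
  rewrite qchar_sqr ?mulf_neq0 ?invr_eq0 //; ring.
rewrite big_split /= -!mulr_sumr (P21_Pfaff HB HC) //; congr (_ + _).
  rewrite expr_div_n [D (1 - x) ^+ 2 / _ * _]mulrA divfK //.
  by rewrite expf_neq0 ?(mchar_neq0 HB).
have [->|x0] := eqVneq x 0.
  rewrite big1 => [|z _]; last by rewrite mul0r.
  by rewrite mulr0 invr0 mulr0 (mchar0 HB) !mulr0.
by rewrite sum_delta.
Qed.

(* Both sides vanish unless [B = D phi]. *)
Lemma boundary_terms_eq x : x != 1 -> 1 + x != 0 ->
  let nu := (1 + x) / (1 - x) in
  (\sum_e E e * phi (1 + e)) *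
    ((\sum_a A a) * (D (- (nu ^+ 2)^-1) / CB (1 - (nu ^+ 2)^-1)))
  = (\sum_t H t * E t) * (kernel 1 * B ((1 - x) ^+ 2 / (4%:R * x))).
Proof.
move=> x1 x1N nu; have x1' : 1 - x != 0 by rewrite subr_eq0 eq_sym.
have HHE t : t != 0 -> H t * E t = (B t / D t) ^+ 2.
  move=> t0; transitivity (phi t * phi t * (B t / D t) ^+ 2).
    by rewrite HtE EE WE; field; rewrite (mchar_neq0 HD).
  by rewrite qchar_mulss // mul1r.
have A_trivial : (forall t, t != 0 -> A t = 1) ->
    forall t, t != 0 -> B t = D t * phi t.
  by move=> A1 t t0; have := A1 t t0; rewrite AE => /divr1_eq ->.
have sumHE : (forall t, t != 0 -> A t = 1) -> \sum_t H t * E t = \sum_t A t.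
  move=> A1; apply: eq_bigr => t _; have [->|t0] := eqVneq t 0.
    by rewrite (mchar0 HE) (mchar0 HA) mulr0.
  rewrite HHE // A1 // (A_trivial A1) // mulrAC divff ?(mchar_neq0 HD) //.
  by rewrite mul1r expr2 qchar_mulss.
have [HE1|HE0] := mchar_trivial_or_sum0 (mchar_cmul HH HE); last first.
  have -> : \sum_t H t * E t = 0 by [].
  suff -> : \sum_a A a = 0 by rewrite !mul0r mulr0.
  by have [A1|//] := mchar_trivial_or_sum0 HA; rewrite -sumHE.
(* Off [0], [H * E] is inverse to the square of [A], so its triviality makes [A] involutive. The
   case [A = phi] means [B = D] and is refuted at the end by [DB0]. *)
have [A1|Aphi] : (forall t, t != 0 -> A t = 1) \/ A =1 phi.
- apply: (mchar_involutive oddF HA) => t t0; apply: invr_inj; rewrite invr1.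
  rewrite -(HE1 t t0) [RHS]HHE // AE !exprMn exprVn.
  rewrite [phi t ^+ 2]expr2 qchar_mulss // mulr1 invfM invrK mulrC.
  by rewrite exprVn.
- rewrite sumHE // mulrCA; congr (_ * _).
  have BE := A_trivial A1.
  have -> : kernel 1 = D (-1) * \sum_e E e * phi (1 + e).
    (* The substitution is [v = - 1 / t - 1]; here [W] is [phi / D] off [0]. *)
    rewrite /kernel -(sum_shift (-1)) -sum_inv -sum_opp mulr_sumr; apply: eq_bigr => t _.
    have [->|t0] := eqVneq t 0.
      by rewrite oppr0 invr0 addrCA subrr addr0 (mchar0 HW) (mchar0 HE) !(mulr0, mul0r).
    have tV0 : (- t)^-1 != 0 by rewrite invr_eq0 oppr_eq0.
    rewrite addrCA subrr addr0 WE EE !BE //.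
    have -> : D t * phi t * phi t = D t by rewrite -mulrA qchar_mulss // mulr1.
    transitivity (phi ((- t)^-1 - 1) * phi (- t)^-1 / D (- t)^-1).
      by field; rewrite (mchar_neq0 HD).
    have DN : D (- t) = D (-1) * D t by rewrite -(mcharM HD) mulN1r.
    rewrite -(mcharM Hphi) -(mcharV HD) invrK DN.
    have -> : ((- t)^-1 - 1) * (- t)^-1 = t^-1 ^+ 2 * (1 + t).
      by field; rewrite ?oppr_eq0 ?t0.
    by rewrite qchar_sqrM ?invr_eq0 // mulrC mulrA.
  have [x0|x0] := eqVneq x 0.
    have -> : 1 - (nu ^+ 2)^-1 = 0.
      by rewrite /nu x0 addr0 subr0 divr1 expr1n invr1 subrr.
    by rewrite x0 (mchar0 HCB) mulr0 !invr0 !mulr0 (mchar0 HB) !mulr0.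
  have -> : 1 - (nu ^+ 2)^-1 = (2%:R / (1 + x)) ^+ 2 * x.
    by rewrite /nu; field; rewrite x1N x1'.
  have -> : - (nu ^+ 2)^-1 = -1 * ((1 - x) / (1 + x)) ^+ 2.
    by rewrite /nu; field; rewrite x1N x1'.
  have -> : (1 - x) ^+ 2 / (4%:R * x) = ((1 - x) / (2%:R * x)) ^+ 2 * x.
    by field; rewrite F4 F2 x0.
  rewrite -(cconjE HCB) WE !BE ?mulf_neq0 ?expf_neq0 ?mulf_neq0 ?invr_eq0 ?mulf_neq0 //.
  rewrite !qchar_sqrM ?mulf_neq0 ?invr_eq0 ?mulf_neq0 //.
  rewrite !(mcharM HD) !(mcharV HD) !(mcharM HD).
  by field; rewrite !(mchar_neq0 HD) ?oppr_eq0 ?oner_eq0.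
suff /(sum_mchar_trivial_neq0 (mchar_cmul HD (mchar_cconj HB)))/eqP[] :
    forall t, t != 0 -> cmul D (cconj B) t = 1.
  transitivity (\sum_t D t / B t) => //.
  by apply: eq_bigr => t _; rewrite /cmul (cconjE HB).
move=> t t0; have := Aphi t; rewrite AE /cmul (cconjE HB) mulrAC => e.
by apply: (mulIf (mchar_neq0 Hphi _ t0)); rewrite mul1r.
Qed.

(** Two evaluations of [double_period] are compared and their equal boundary terms cancelled. The
    value [x = -1] is excluded because [nu] would be [0]. *)
Lemma quadratic_P21 x : x != 1 -> 1 + x != 0 ->
  (\sum_e E e * phi (1 + e)) * (\sum_a A a / CB (1 + a)) *
    P21 A D CB (- 4%:R * x / (1 - x) ^+ 2)
  = (\sum_t kernel t * E (1 + t)) * (B 4%:R / D 4%:R ^+ 2) *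
    (D (1 - x) ^+ 2 * P21 B C CB x).
Proof.
move=> x1 x1N; have x1' : 1 - x != 0 by rewrite subr_eq0 eq_sym.
pose nu := (1 + x) / (1 - x).
have nu0 : nu != 0 by rewrite mulf_neq0 ?invr_eq0.
have -> : - 4%:R * x / (1 - x) ^+ 2 = 1 - nu ^+ 2 by rewrite /nu; field.
have := dihedral_P21 x x1; rewrite -/nu -double_period_dihedral //.
rewrite double_period_P21 // mulrDr.
by rewrite (boundary_terms_eq x x1 x1N) => /addIr; rewrite !mulrA.
Qed.

Lemma dihedral_factor_neq0 : \sum_e E e * phi (1 + e) != 0.
Proof.
rewrite (Jac_shift _ _ HE) mulf_neq0 ?(Jac_neq0 HE Hphi) ?sum_qchar //.
by rewrite (mchar_neq0 HE) // oppr_eq0 oner_eq0.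
Qed.

(** Up to a nonzero factor this is [Jac A W], which is nonzero once [A] or [W] is nontrivial. Off
    [0] their product is [phi / D], so by [Dphi0] they are not both trivial. *)
Lemma double_period_factor_neq0 : \sum_a A a / CB (1 + a) != 0.
Proof.
under eq_bigr do rewrite -(cconjE HCB).
rewrite (Jac_shift _ _ HA) mulf_neq0 //.
  by rewrite (mchar_neq0 HA) // oppr_eq0 oner_eq0.
have [A1|A0] := mchar_trivial_or_sum0 HA; last by rewrite Jac_sym (Jac_neq0 HW HA).
have [W1|W0] := mchar_trivial_or_sum0 HW; last exact: (Jac_neq0 HA HW).
suff /(sum_mchar_trivial_neq0 (mchar_cmul HD Hphi))/eqP[] :
    forall t, t != 0 -> cmul D phi t = 1 by [].
move=> t t0; apply: invr_inj; rewrite invr1 -[RHS]mulr1 -{1}(A1 t t0) -(W1 t t0).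
rewrite AE WE /cmul invfM qcharV //; field.
by rewrite (mchar_neq0 HD) // (mchar_neq0 HB).
Qed.

Let cancelD t : cmul CB (cconj D) t = D t / B t.
Proof.
rewrite /cmul (cconjE HB) (cconjE HD).
have [->|t0] := eqVneq t 0; first by rewrite (mchar0 HD) !mul0r.
by field; rewrite (mchar_neq0 HD) // (mchar_neq0 HB).
Qed.

Let Jac_D_neq0 : Jac D (cmul CB (cconj D)) != 0.
Proof.
apply: (Jac_neq0 HD (mchar_cmul HCB (mchar_cconj HD))).
by under eq_bigr do rewrite cancelD.
Qed.

Lemma F21_quadratic x : x != 1 -> 1 + x != 0 ->
  cconj C (1 - x) * F21 A D CB (- 4%:R * x / (1 - x) ^+ 2) = F21 B C CB x.
Proof.
move=> x1 x1N; have x1' : 1 - x != 0 by rewrite subr_eq0 eq_sym.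
have := quadratic_P21 x x1 x1N.
have n01 : (0 : F) != 1 by rewrite eq_sym oner_neq0.
have n10 : 1 + 0 != 0 :> F by rewrite addr0 oner_neq0.
have := quadratic_P21 0 n01 n10.
rewrite mulr0 mul0r subr0 (mchar1 HD) expr1n mul1r (P21_0 HA) (P21_0 HB).
have := mulf_neq0 dihedral_factor_neq0 double_period_factor_neq0.
move: Jac_D_neq0 (mchar_neq0 HD _ x1'); rewrite /F21 (cconjE HC) /=.
have -> : C (1 - x) = D (1 - x) ^+ 2 by [].
move: (_ * _) (_ * (B 4%:R / _)) => g l.
move: (D (1 - x)) (P21 A _ _ _) (P21 B _ _ _) => d PL PR.
move: (Jac D _) (Jac C _) => JL JR JL0 d0 g0 e0 ex.
(* At [x = 0] both period functions are Jacobi sums. Besides fixing the constant, this instance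
   shows that [l] and [JR] are nonzero, since they multiply to a nonzero quantity. *)
have := mulf_neq0 g0 JL0; rewrite e0 mulf_eq0 negb_or => /andP[l0 JR0].
have -> : PL = l * (d ^+ 2 * PR) / g by rewrite -ex mulrC mulKf.
have -> : JL = l * JR / g by rewrite -e0 mulrC mulKf.
by field; rewrite d0 g0 l0 JR0.
Qed.

(** On the left, argument [1] collapses the period function to [Jac D phi]. On the right, the
    summand depends only on [y ^+ 2]; counting square roots gives two Jacobi sums, one of which is
    the correction term. [Jac_duplication] matches the rest, with [C 2 = D 4]. *)
Lemma F21_quadratic_N1 :
  cconj C 2%:R * F21 A D CB 1
  = F21 B C CB (-1) - Jac (cconj B) (cmul D phi) / Jac C (cmul CB (cconj C)).
Proof.
have HBb := mchar_cconj HB.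
have cancelC t : cmul CB (cconj C) t = cconj B t.
  rewrite /cmul (cconjE HC) (cconjE HB) /cmul.
  have [->|t0] := eqVneq t 0; first by rewrite (mchar0 HD) (mchar0 HB) !mul0r invr0.
  by field; rewrite (mchar_neq0 HD) // (mchar_neq0 HB).
have JC : Jac C (cmul CB (cconj C)) = Jac C (cconj B).
  by apply: eq_bigr => y _; rewrite cancelC.
have JD : Jac D (cmul CB (cconj D)) = Jac D (cmul D (cconj B)).
  by apply: eq_bigr => y _; rewrite cancelD /cmul (cconjE HB).
have PL : P21 A D CB 1 = Jac D phi.
  apply: eq_bigr => y _; rewrite mul1r -mulrA; congr (_ * _).
  have -> : cmul (cconj D) CB (1 - y) = D (1 - y) / B (1 - y).
    by rewrite -cancelD [RHS]mulrC.
  have [->|y0] := eqVneq (1 - y) 0; first by rewrite (mchar0 HD) qchar0 !mul0r.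
  rewrite (cconjE HA) AE.
  have p0 : (phi (1 - y))^-1 = phi (1 - y) by rewrite qcharV.
  rewrite -[RHS]p0; field.
  by rewrite !(mchar_neq0 HD, mchar_neq0 HB, mchar_neq0 Hphi).
have PR : P21 B C CB (-1) = Jac D (cconj B) + Jac (cconj B) (cmul D phi).
  rewrite [X in _ + X]Jac_sym -big_split /=.
  transitivity (\sum_y 1 * (D (y ^+ 2) * cconj B (1 - y ^+ 2))).
    apply: eq_bigr => y _; rewrite mul1r mulN1r opprK (mcharX HD) -mulrA; congr (_ * _).
    rewrite (_ : 1 - y ^+ 2 = (1 - y) * (1 + y)); last by ring.
    rewrite (mcharM HBb); congr (_ * _).
    by rewrite -cancelC [RHS]mulrC.
  rewrite (sum_fiber _ _ _ (fun y => y ^+ 2) (fun=> 1) (fun v => D v * cconj B (1 - v))).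
  by apply: eq_bigr => v _; rewrite card_sqrt // /cmul; ring.
have dup := Jac_duplication oddF HD HBb _ Dphi0.
have {}dup : Jac D (cconj B) * Jac D (cmul D (cconj B))
    = Jac C (cconj B) * (Jac D phi / D 4%:R).
  by apply: dup; under eq_bigr do rewrite (cconjE HB).
have J1 : Jac D (cconj B) != 0.
  have [B1|B0] := mchar_trivial_or_sum0 HBb; last exact: (Jac_neq0 HD HBb).
  rewrite Jac_sym (Jac_neq0 HBb HD) //.
  have [D1|//] := mchar_trivial_or_sum0 HD.
  suff /(sum_mchar_trivial_neq0 (mchar_cmul HD HBb))/eqP[] :
    forall t, t != 0 -> cmul D (cconj B) t = 1.
    transitivity (\sum_t D t / B t) => //.
    by apply: eq_bigr => t _; rewrite /cmul (cconjE HB).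
  by move=> t t0; rewrite /cmul B1 // D1 // mulr1.
move: Jac_D_neq0; rewrite /F21 JC JD PL PR -mulrBl addrK => J2.
have JR : Jac C (cconj B) != 0.
  by apply: contraTneq (mulf_neq0 J1 J2) => J0; rewrite dup J0 mul0r eqxx.
rewrite (cconjE HC) -[C _](mcharM HD) -(natrM _ 2 2).
apply: (mulIf (mulf_neq0 JR J2)).
transitivity (Jac C (cconj B) * (Jac D phi / D 4%:R)).
  by field; rewrite J2 (mchar_neq0 HD).
by rewrite -dup; field; rewrite JR.
Qed.

End QuadraticTransformation.

(** * Assembly of the cases [x = 1], [x = -1] and generic [x] *)

Theorem mainTheorem7 (F : finFieldType) (Hodd : odd #|F|)
    (B D : F -> algC) (HB : is_mchar B) (HD : is_mchar D)
    (HDphi : D <> qchar (F:=F)) (HBD : B <> D) (x : F) :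
  let C := cmul D D in
  let Bb := cconj B in
  (if x == 1 then 0 else
     cconj C (1 - x) *
       F21 (cmul (cmul D (qchar (F:=F))) Bb) D (cmul C Bb)
           (- 4%:R * x / (1 - x) ^+ 2))
  = F21 B C (cmul C Bb) x
    - kdelta (1 - x) * (Jac C (cmul Bb Bb) / Jac C Bb)
    - kdelta (1 + x) * (Jac Bb (cmul D (qchar (F:=F))) / Jac C Bb).
Proof.
move=> C Bb.
have Hphi := qchar_mchar Hodd; have HC := mchar_cmul HD HD.
have HBb := mchar_cconj HB; have F2 := two_neq0 Hodd.
have Dphi0 : \sum_t D t * qchar t = 0.
  have [Dphi1|//] := mchar_trivial_or_sum0 (mchar_cmul HD Hphi).
  case: HDphi; apply: functional_extensionality => t.
  have [->|t0] := eqVneq t 0; first by rewrite (mchar0 HD) qchar0.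
  have := Dphi1 t t0; rewrite /cmul -{1}(qcharV Hodd); exact: divr1_eq.
have DB0 : \sum_t D t / B t = 0.
  under eq_bigr do rewrite -(cconjE HB).
  have [DB1|//] := mchar_trivial_or_sum0 (mchar_cmul HD HBb).
  case: HBD; apply: functional_extensionality => t.
  have [->|t0] := eqVneq t 0; first by rewrite (mchar0 HD) (mchar0 HB).
  by have := DB1 t t0; rewrite /cmul (cconjE HB) => /divr1_eq ->.
have cancelC t : cmul (cmul C Bb) (cconj C) t = Bb t.
  have [->|t0] := eqVneq t 0; first by rewrite /cmul /Bb (mchar0 HBb) mulr0 mul0r.
  rewrite /cmul (cconjE HC) -/(C t).
  by rewrite mulrAC divff ?mul1r // (mchar_neq0 HC).
have JC : Jac C (cmul (cmul C Bb) (cconj C)) = Jac C Bb.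
  by apply: eq_bigr => y _; rewrite cancelC.
rewrite /kdelta; have [->|x1] := eqVneq x 1.
  (* At [x = 1] the factors at [1 - y] and [1 - x y] merge into the square of [Bb], so the first
     correction cancels the right side; the second is absent because [2 != 0]. *)
  rewrite subrr eqxx -(natrD _ 1 1) (negPf F2) mul0r subr0 mul1r /F21 JC.
  rewrite (_ : P21 B C _ 1 = Jac C (cmul Bb Bb)) ?subrr //.
  apply: eq_bigr => y _; rewrite mul1r -mulrA; congr (_ * _).
  by rewrite [RHS]/cmul; congr (_ * _); rewrite -cancelC [RHS]mulrC.
rewrite subr_eq0 [1 == x]eq_sym (negPf x1) mul0r subr0.
have [x1N|x1N] := eqVneq (1 + x) 0; last by rewrite mul0r subr0 F21_quadratic.
have -> : x = -1 by apply/eqP; rewrite -addr_eq0 addrC x1N.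
rewrite mul1r -JC opprK -(natrD _ 1 1) -(F21_quadratic_N1 Hodd HB HD Dphi0 DB0).
by congr (_ * F21 _ _ _ _); field; exact: four_neq0.
Qed.
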